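(* Let $\Gamma$ be one of the following groups: $\mathbb{Z}_m\,\mathrm{wr}\,\mathbb{Z}$ with $m$ a positive integer relatively prime to $6$; or $\mathbb{Z}_p\,\mathrm{wr}\,\mathbb{Z}^k$ with $p>3$ prime and $k\ge1$ arbitrary; or $\mathbb{Z}_3\,\mathrm{wr}\,\mathbb{Z}^{2d}$ with $d\ge1$. Then the twisted Burnside–Frobenius theorem holds for $\Gamma$: for every automorphism $\phi:\Gamma\to\Gamma$ with $R(\phi)<\infty$, $R(\phi)$ equals the number of equivalence classes $[\rho]$ of finite-dimensional irreducible unitary representations $\rho$ of $\Gamma$ that are fixed by the map $\widehat{\phi}:[\rho]\mapsto[\rho\circ\phi]$.
   Context: For an automorphism $\phi$ of a group $G$, $R(\phi)$ is the number of Reidemeister classes, i.e. classes of the relation $g\sim hg\phi(h^{-1})$, $h,g\in G$. For $n\ge1$ and $k\ge1$, the restricted wreath product $\mathbb{Z}_n\,\mathrm{wr}\,\mathbb{Z}^k$ is $\left(\bigoplus_{x\in\mathbb{Z}^k}A_x\right)\rtimes_\alpha\mathbb{Z}^k$ with $A_x\cong\mathbb{Z}_n$ generated by $\delta_x$, finitely supported direct sum, and $\alpha(y)(\delta_x)=\delta_{y+x}$. *)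

(* Defs.v *)
From HB Require Import structures.
From mathcomp Require Import all_boot all_algebra.
From mathcomp Require Import reals Rstruct complex.
Set Implicit Arguments. Unset Strict Implicit. Unset Printing Implicit Defensive.
Import GRing.Theory Num.Theory.
Local Open Scope ring_scope.

Definition CC : numClosedFieldType := complex Rdefinitions.R.

Definition Zk (k : nat) := 'rV[int]_k.

(** Z_m for m >= 1 : the integers mod m, represented as 'I_m
    (written 'I_(m.-1).+1 so that it carries MathComp's Z/mZ structure;
    for m >= 1 this is literally 'I_m, including m = 1, the trivial group). *)
Definition lamp (m : nat) : zmodType := 'I_(m.-1).+1.

Definition finsupp m k (a : Zk k -> lamp m) : Prop :=
  exists s : seq (Zk k), forall x, a x != 0 -> x \in s.

(** alpha(y) acting on configurations: (alpha(y) b)(x) = b(x - y),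
    so that alpha(y)(delta_x) = delta_(y + x). *)
Definition shiftc m k (y : Zk k) (b : Zk k -> lamp m) : Zk k -> lamp m :=
  fun x => b (x - y).

Lemma finsupp0 m k : finsupp (fun _ : Zk k => (0 : lamp m)).
Proof. by exists [::] => x; rewrite eqxx. Qed.

Lemma finsupp_mul m k (a b : Zk k -> lamp m) y :
  finsupp a -> finsupp b -> finsupp (fun x => a x + shiftc y b x).
Proof.
move=> [s Hs] [t Ht]; exists (s ++ map (fun z => z + y) t) => x Hx.
rewrite mem_cat; case: (eqVneq (a x) 0) => [Ha|Ha]; last by rewrite Hs.
move: Hx; rewrite Ha add0r /shiftc => /Ht Hxy.
apply/orP; right; apply/mapP; exists (x - y) => //; by rewrite subrK.
Qed.

Lemma finsupp_inv m k (a : Zk k -> lamp m) y :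
  finsupp a -> finsupp (fun x => - shiftc (- y) a x).
Proof.
move=> [s Hs]; exists (map (fun z => z - y) s) => x Hx.
apply/mapP; exists (x - - y); last by rewrite opprK addrK.
by apply: Hs; move: Hx; rewrite oppr_eq0.
Qed.

Definition wr (m k : nat) := {p : (Zk k -> lamp m) * Zk k | finsupp p.1}.

Definition wr_one m k : wr m k := exist _ (fun _ => 0, 0) (finsupp0 m k).

Definition wr_mul m k (g h : wr m k) : wr m k :=
  exist _ (fun x => (sval g).1 x + shiftc (sval g).2 (sval h).1 x,
           (sval g).2 + (sval h).2)
        (finsupp_mul (sval g).2 (proj2_sig g) (proj2_sig h)).

Definition wr_inv m k (g : wr m k) : wr m k :=
  exist _ (fun x => - shiftc (- (sval g).2) (sval g).1 x, - (sval g).2)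
        (finsupp_inv (sval g).2 (proj2_sig g)).

Definition is_automorphism m k (phi : wr m k -> wr m k) : Prop :=
  bijective phi /\ forall g h, phi (wr_mul g h) = wr_mul (phi g) (phi h).

Definition reid_rel m k (phi : wr m k -> wr m k) (g g' : wr m k) : Prop :=
  exists h, g' = wr_mul (wr_mul h g) (phi (wr_inv h)).

Definition num_classes (T : Type) (E : T -> T -> Prop) (n : nat) : Prop :=
  exists f : 'I_n -> T,
    (forall i j, E (f i) (f j) -> i = j) /\ (forall x, exists i, E x (f i)).

Definition num_classes_on (T : Type) (P : T -> Prop) (E : T -> T -> Prop)
    (n : nat) : Prop :=
  exists f : 'I_n -> T,
    (forall i, P (f i)) /\
    (forall i j, E (f i) (f j) -> i = j) /\
    (forall x, P x -> exists i, E x (f i)).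

Definition adjmx (p q : nat) (A : 'M[CC]_(p, q)) : 'M[CC]_(q, p) :=
  (map_mx Num.conj A)^T.

Definition unitary_mx (d : nat) (U : 'M[CC]_d) : Prop :=
  U *m adjmx U = 1%:M /\ adjmx U *m U = 1%:M.

Definition rep m k := {d : nat & wr m k -> 'M[CC]_d}.

Definition rep_dim m k (r : rep m k) : nat := projT1 r.
Definition rep_map m k (r : rep m k) : wr m k -> 'M[CC]_(rep_dim r) := projT2 r.

Definition is_unitary_rep m k (r : rep m k) : Prop :=
  (forall g, unitary_mx (rep_map r g)) /\
  (forall g h, rep_map r (wr_mul g h) = rep_map r g *m rep_map r h).

(** Irreducible: nonzero space with no invariant subspaces except 0 and
    the whole space (subspaces = row spaces of square matrices). *)
Definition is_irreducible m k (r : rep m k) : Prop :=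
  (0 < rep_dim r)%N /\
  forall U : 'M[CC]_(rep_dim r),
    (forall g, (U *m rep_map r g <= U)%MS) ->
    \rank U = 0%N \/ \rank U = rep_dim r.

Definition irr_unitary_rep m k (r : rep m k) : Prop :=
  is_unitary_rep r /\ is_irreducible r.

Definition rep_equiv m k (r s : rep m k) : Prop :=
  exists P : 'M[CC]_(rep_dim r, rep_dim s),
    P *m adjmx P = 1%:M /\ adjmx P *m P = 1%:M /\
    forall g, rep_map r g *m P = P *m rep_map s g.

Definition rep_comp m k (r : rep m k) (phi : wr m k -> wr m k) : rep m k :=
  existT _ (rep_dim r) (fun g => rep_map r (phi g)).

Definition fixed_irrep m k (phi : wr m k -> wr m k) (r : rep m k) : Prop :=
  irr_unitary_rep r /\ rep_equiv (rep_comp r phi) r.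

Definition theorem5p1_group (m k : nat) : Prop :=
  [/\ k = 1%N, (0 < m)%N & coprime m 6]
  \/ [/\ prime m, (3 < m)%N & (1 <= k)%N]
  \/ (m = 3%N /\ exists d : nat, (1 <= d)%N /\ k = (2 * d)%N).

(* Main.v *)
(** Write an automorphism phi of Z_m wr Z^k through its action S on Z^k and its
    restriction phi' to the torsion subgroup A, the direct sum of the lamps.  If
    R(phi) is finite then 1 - S is injective on Z^k, so that the classes lying
    over z are the cosets of (1 - tau) A with tau = alpha(z) phi', and A/(1 - tau) A
    is finite.  Such a finite quotient is trivial.  Indeed, modulo a prime p
    dividing m, tau maps each delta_x to c delta_(T x) for a nonzero constant c and
    an affine map T, since F_p[Z^k] has only trivial units.  An orbit of T carries a
    tau-invariant functional unless some T^s fixes its points with c^s <> 1, and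
    one orbit carrying such a functional gives infinitely many, by homotheties
    centred at the rational fixed point of T (if the orbit is that point itself,
    then c = 1 and every orbit qualifies).  Hence Reidemeister classes
    are the preimages of the cosets of Z^k (1 - S).  Likewise, a character of A
    occurring in a fixed irreducible representation is tau-invariant for some z,
    hence trivial, and the fixed irreducible representations are the characters of
    Z^k / Z^k (1 - S). *)

Require Import Defs.
From HB Require Import structures.
From mathcomp Require Import all_boot all_order all_algebra.
From mathcomp Require Import cyclic separable cyclotomic boolp spectral zify.

Set Implicit Arguments.
Unset Strict Implicit.
Unset Printing Implicit Defensive.
Import Order.TTheory GRing.Theory Num.Theory.
Local Open Scope ring_scope.

(** * Finitely supported configurations *)

Definition conf (m k : nat) := {a : Zk k -> lamp m | finsupp a}.

Section Conf.
Variables m k : nat.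
Implicit Types (a b : conf m k) (x y : Zk k).

HB.instance Definition _ := gen_eqMixin (conf m k).
HB.instance Definition _ := gen_choiceMixin (conf m k).

Lemma conf_ext a b : sval a =1 sval b -> a = b.
Proof.
case: a b => [a sa] [b sb] /= eq_ab; have eab : a = b by apply: funext.
by rewrite eab in sa *; congr exist; apply: Prop_irrelevance.
Qed.

Lemma finsupp_add (a b : Zk k -> lamp m) :
  finsupp a -> finsupp b -> finsupp (fun x => a x + b x).
Proof.
move=> sa sb; have := finsupp_mul 0 sa sb.
by rewrite /shiftc; under eq_fun do rewrite subr0.
Qed.

Lemma finsupp_opp (a : Zk k -> lamp m) : finsupp a -> finsupp (fun x => - a x).
Proof.
move=> sa; have := finsupp_inv 0 sa.
by rewrite /shiftc; under eq_fun do rewrite oppr0 subr0.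
Qed.

Lemma finsupp_shift (a : Zk k -> lamp m) y :
  finsupp a -> finsupp (fun x => a (x - y)).
Proof.
move=> sa; have := finsupp_mul y (finsupp0 m k) sa.
by rewrite /shiftc; under eq_fun do rewrite add0r.
Qed.

Definition conf0 : conf m k := exist _ _ (finsupp0 m k).
Definition conf_add a b : conf m k :=
  exist _ _ (finsupp_add (proj2_sig a) (proj2_sig b)).
Definition conf_opp a : conf m k := exist _ _ (finsupp_opp (proj2_sig a)).

Lemma conf_addA : associative conf_add.
Proof. by move=> a b c; apply: conf_ext => x /=; rewrite addrA. Qed.
Lemma conf_addC : commutative conf_add.
Proof. by move=> a b; apply: conf_ext => x /=; rewrite addrC. Qed.
Lemma conf_add0 : left_id conf0 conf_add.
Proof. by move=> a; apply: conf_ext => x /=; rewrite add0r. Qed.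
Lemma conf_addN : left_inverse conf0 conf_opp conf_add.
Proof. by move=> a; apply: conf_ext => x /=; rewrite addNr. Qed.

HB.instance Definition _ :=
  GRing.isZmodule.Build (conf m k) conf_addA conf_addC conf_add0 conf_addN.

Lemma confDE a b x : sval (a + b) x = sval a x + sval b x. Proof. by []. Qed.
Lemma confNE a x : sval (- a) x = - sval a x. Proof. by []. Qed.

Lemma confMnE a n x : sval (a *+ n) x = sval a x *+ n.
Proof. by elim: n => [|n IHn] //; rewrite !mulrS confDE IHn. Qed.

Definition shc y a : conf m k := exist _ _ (finsupp_shift y (proj2_sig a)).

Lemma shcE y a x : sval (shc y a) x = sval a (x - y). Proof. by []. Qed.

Lemma shcD y a b : shc y (a + b) = shc y a + shc y b.
Proof. exact: conf_ext. Qed.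

Lemma shc_shc y z a : shc y (shc z a) = shc (y + z) a.
Proof. by apply: conf_ext => x; rewrite !shcE opprD addrA. Qed.

Lemma shc0 a : shc 0 a = a.
Proof. by apply: conf_ext => x; rewrite shcE subr0. Qed.

(** [inZp 1] also makes sense for [m = 1], where the lamps are trivial and it equals [0]. *)
Definition lamp1 : lamp m := inZp 1.

Lemma lamp1Mn (n : nat) : lamp1 *+ n = inZp n :> lamp m.
Proof.
elim: n => [|n IHn]; first by apply/val_inj; rewrite /= mod0n.
rewrite mulrS IHn; apply/val_inj; rewrite /= modnDm.
by rewrite add1n.
Qed.

Lemma lamp1K (c : lamp m) : lamp1 *+ (c : 'I_(m.-1).+1) = c.
Proof. by rewrite lamp1Mn valZpK. Qed.

Lemma confMm a : (0 < m)%N -> a *+ m = 0.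
Proof.
move=> m_gt0; apply: conf_ext => x; rewrite confMnE -(lamp1K (sval a x)).
have modm n : (n * m %% m.-1.+1 = 0)%N by rewrite prednK // modnMl.
by rewrite -mulrnA lamp1Mn; apply: val_inj; apply: modm.
Qed.

Lemma finsupp_delta x : finsupp (fun y => if y == x then lamp1 else 0).
Proof.
by exists [:: x] => y; rewrite inE; case: (y == x) => //; rewrite eqxx.
Qed.

Definition delta x : conf m k := exist _ _ (finsupp_delta x).

Lemma deltaE x y : sval (delta x) y = if y == x then lamp1 else 0.
Proof. by []. Qed.

Lemma shc_delta y x : shc y (delta x) = delta (y + x).
Proof.
by apply: conf_ext => z; rewrite shcE !deltaE subr_eq [x + y]addrC.
Qed.

(** Induction on a list containing the support, one point at a time; sums suffice because every lamp
    value is a natural multiple of [lamp1]. *)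
Lemma conf_ind (P : conf m k -> Prop) :
  P 0 -> (forall a b, P a -> P b -> P (a + b)) ->
  (forall x, P (delta x)) -> forall a, P a.
Proof.
move=> P0 PD Pd.
have PMn a n : P a -> P (a *+ n).
  by move=> Pa; elim: n => [|n IHn]; rewrite ?mulrS //; apply: PD.
suff H (s : seq (Zk k)) a : (forall x, sval a x != 0 -> x \in s) -> P a.
  by move=> a; have [s /H] := proj2_sig a.
elim: s a => [|x s IHs] a sa.
  suff -> : a = 0 by [].
  by apply: conf_ext => y; apply/eqP/negPn/negP => /sa.
pose d := delta x *+ (sval a x : 'I_(m.-1).+1).
rewrite -[a](subrK d); apply: PD; last exact: PMn.
apply: IHs => y; rewrite confDE confNE confMnE deltaE.
have [->|ne_yx] := eqVneq y x; first by rewrite lamp1K subrr eqxx.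
by rewrite mul0rn subr0 => /sa; rewrite inE (negPf ne_yx).
Qed.

End Conf.

(** * Reduction modulo a prime divisor of [m], and functionals on the lamp group *)

Section Functional.
Variables (m k p : nat).
Hypotheses (m_gt0 : (0 < m)%N) (p_pr : prime p) (p_dvd_m : (p %| m)%N).
Implicit Types (a b : conf m k) (x y : Zk k).

Definition red (c : lamp m) : 'F_p := (c : 'I_(m.-1).+1)%:R.

Lemma natr_modm (n : nat) : (n %% m.-1.+1)%:R = n%:R :> 'F_p.
Proof.
rewrite prednK // {2}(divn_eq n m) natrD natrM.
suff -> : m%:R = 0 :> 'F_p by rewrite mulr0 add0r.
by apply/eqP; rewrite -(dvdn_pcharf (pchar_Fp p_pr)).
Qed.

Lemma red0 : red 0 = 0. Proof. by []. Qed.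

Lemma redD (c d : lamp m) : red (c + d) = red c + red d.
Proof. by rewrite /red -natrD -[RHS]natr_modm. Qed.

Lemma red_lamp1 : red (lamp1 m) = 1.
Proof. by rewrite /red /= natr_modm. Qed.

(** Divide the natural representative of each entry by [p]. *)
Lemma red_eq0 a : (forall x, red (sval a x) = 0) -> exists d, a = d *+ p.
Proof.
move=> a0; pose n x : nat := sval a x : 'I_(m.-1).+1.
have fd : finsupp (fun x => inZp (n x %/ p) : lamp m).
  have [s sa] := proj2_sig a; exists s => x dx; apply: sa.
  apply: contraNneq dx => ax0; rewrite /n ax0 div0n; exact/eqP/val_inj.
exists (exist _ _ fd); apply: conf_ext => x; rewrite confMnE /=.
rewrite -lamp1Mn -mulrnA divnK ?lamp1K //.
by rewrite (dvdn_pcharf (pchar_Fp p_pr)); apply/eqP/a0.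
Qed.

(** The functional with value [f x] at [delta m x]; [f] may have infinite support. The list covering
    the support of [a] is a choice, immaterial by [functE]. *)
Definition funct (f : Zk k -> 'F_p) a : 'F_p :=
  \sum_(x <- undup (sval (cid (proj2_sig a)))) red (sval a x) * f x.

Lemma functE f a (s : seq (Zk k)) :
  uniq s -> (forall x, red (sval a x) != 0 -> x \in s) ->
  funct f a = \sum_(x <- s) red (sval a x) * f x.
Proof.
move=> s_uniq sa; rewrite /funct; case: cid => t /= ta.
have tr r : \sum_(x <- r) red (sval a x) * f x
    = \sum_(x <- [seq x <- r | red (sval a x) != 0]) red (sval a x) * f x.
  rewrite big_filter [RHS]big_mkcond; apply: eq_bigr => x _.
  by case: eqP => [->|]; rewrite ?mul0r.
rewrite tr [RHS]tr; apply/perm_big/uniq_perm;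
  rewrite ?filter_uniq ?undup_uniq //.
move=> x; rewrite !mem_filter mem_undup; case: eqP => //= /eqP a_x.
rewrite (sa _ a_x) ta //; apply: contraNneq a_x => ->.
by rewrite red0.
Qed.

Lemma functD f a b : funct f (a + b) = funct f a + funct f b.
Proof.
have [[s sa] [t tb]] := (proj2_sig a, proj2_sig b).
have r0 (c : conf m k) x : red (sval c x) != 0 -> sval c x != 0.
  by apply: contraNneq => ->; rewrite red0.
have u := undup_uniq (s ++ t).
rewrite !(functE f u) -?big_split /= => [|x /r0 b_x|x /r0 a_x|x /(r0 (a + b)) ab_x].
- by apply: eq_bigr => x _; rewrite redD mulrDl.
- by rewrite mem_undup mem_cat tb ?orbT.
- by rewrite mem_undup mem_cat sa.
rewrite mem_undup mem_cat.
have [a0|/sa -> //] := eqVneq (sval a x) 0.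
by rewrite tb ?orbT //; move: ab_x; rewrite confDE a0 add0r.
Qed.

Lemma functMn f a n : funct f (a *+ n) = funct f a *+ n.
Proof.
elim: n => [|n IHn]; last by rewrite !mulrS functD IHn.
by rewrite (@functE f 0 [::]) ?big_nil // => x; rewrite red0 eqxx.
Qed.

Lemma functN f a : funct f (- a) = - funct f a.
Proof.
by apply/eqP; rewrite -addr_eq0 -functD addNr (functMn f 0 0).
Qed.

Lemma funct_delta f x : funct f (delta m x) = f x.
Proof.
rewrite (@functE f _ [:: x]) // => [|y].
  by rewrite big_seq1 deltaE eqxx red_lamp1 mul1r.
by rewrite deltaE inE; case: (y == x) => //; rewrite red0 eqxx.
Qed.

Lemma functMp f a : funct f (a *+ p) = 0.
Proof. by rewrite functMn -mulr_natr pchar_Fp_0 ?mulr0. Qed.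

End Functional.

(** * Integer row vectors *)

Section Lattice.
Variable k : nat.
Implicit Types (x y v : 'rV[int]_k).

(* Evaluating the polynomial with coefficient vector x at a large enough
   integer separates the points of a finite set. *)
Lemma separating_functional (s : seq 'rV[int]_k) :
  exists2 l : 'rV[int]_k -> int,
    {morph l : x y / x - y} & {in s &, injective l}.
Proof.
pose q := \prod_(x <- s) \prod_(y <- s | x != y) rVpoly (x - y).
have q0 : q != 0.
  rewrite prodf_seq_neq0; apply/allP => x _ /=.
  rewrite prodf_seq_neq0; apply/allP => y _ /=; apply/implyP.
  rewrite -subr_eq0; apply: contra_neq => xy0.
  by apply: (can_inj rVpolyK); rewrite xy0 linear0.
have /allPn[N _ qN] : ~~ all (root q) (map Posz (iota 0 (size q))).
  apply/negP => rq; have := max_poly_roots q0 rq.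
  rewrite map_inj_uniq ?iota_uniq // => [|? ? []//].
  by rewrite size_map size_iota ltnn => /(_ isT).
exists (fun x => (rVpoly x).[N]) => [x y|x y xs ys /= eq_xy].
  by rewrite linearB /= hornerD hornerN.
apply: contraNeq qN => ne_xy; rewrite /q rootE horner_prod.
rewrite prodf_seq_eq0; apply/hasP; exists x => //=.
rewrite horner_prod prodf_seq_eq0; apply/hasP; exists y => //=.
by rewrite ne_xy linearB /= hornerD hornerN eq_xy subrr.
Qed.

Lemma scale_rowI (z : int) : z != 0 -> injective (fun x => z *: x).
Proof.
move=> z0 x y /rowP eq_zxy; apply/rowP => i.
by have := eq_zxy i; rewrite !mxE => /(mulfI z0).
Qed.

Definition content v : nat := \big[gcdn/0%N]_i `|v ord0 i|%N.

Lemma content_eq0 v : content v = 0%N -> v = 0.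
Proof.
move=> cv0; apply/rowP => i; rewrite mxE; apply/eqP.
by rewrite -absz_eq0 -dvd0n -[X in (X %| _)%N]cv0; apply: (biggcdn_inf i).
Qed.

Lemma content_scale (a : nat) v : content (a%:Z *: v) = (a * content v)%N.
Proof.
rewrite /content (big_morph (muln a) (muln_gcdr a) (muln0 a)).
by apply: eq_bigr => i _; rewrite mxE abszM.
Qed.

Lemma content_mul v (S : 'M_k) : (content v %| content (v *m S))%N.
Proof.
apply/dvdn_biggcdP => i _; rewrite mxE.
apply: (big_ind (fun z : int => content v %| `|z|)%N) => [|y z|j _].
- exact: dvdn0.
- move=> dy dz; suff: (content v %| y + z)%Z by [].
  by apply: rpredD.
by rewrite abszM dvdn_mulr //; apply: (biggcdn_inf j).
Qed.

(** Apply [content_mul] to [S] and to [S']. This invariant will tell the orbits of an affine map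
    apart. *)
Lemma content_unimodular v (S S' : 'M_k) :
  S *m S' = 1%:M -> content (v *m S) = content v.
Proof.
move=> SS'; apply/eqP; rewrite eqn_dvd content_mul andbT.
by have := content_mul (v *m S) S'; rewrite -mulmxA SS' mulmx1.
Qed.

End Lattice.

Lemma exists_maximum (T : eqType) (s : seq T) (f : T -> int) x0 :
  x0 \in s -> exists2 x, x \in s & {in s, forall y, f y <= f x}.
Proof.
elim: s x0 => // x s IHs _ _; case: s IHs => [_|y s IHs].
  by exists x; rewrite ?mem_head // => y; rewrite inE => /eqP->.
have [z zs maxz] := IHs y (mem_head _ _).
case: (leP (f x) (f z)) => [le_xz|/ltW le_zx].
  exists z; first by rewrite inE zs orbT.
  by move=> t; rewrite inE => /predU1P[->//|/maxz].
exists x; rewrite ?mem_head // => t; rewrite inE => /predU1P[->//|/maxz].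
by move/le_trans; apply.
Qed.

(* f x0 = 1 forces f (T^s x0) = c^-s along the orbit of x0, which is consistent
   as soon as c^s = 1 whenever T^s fixes x0. *)
Lemma orbit_weight (X : Type) (T : X -> X) (F : fieldType) (c : F) x0 :
  injective T -> c != 0 -> (forall s, iter s T x0 = x0 -> c ^+ s = 1) ->
  exists f : X -> F, [/\ f x0 = 1, forall x, f x = c * f (T x)
    & forall x, f x != 0 -> exists s t, iter s T x = iter t T x0].
Proof.
move=> injT c0 per.
have inj_iter s : injective (iter s T) by elim: s => // s IHs x y /= /injT/IHs.
have consist x s t s' t' : iter s T x = iter t T x0 ->
    iter s' T x = iter t' T x0 -> c ^+ s / c ^+ t = c ^+ s' / c ^+ t'.
  move=> e e'.
  suff : c ^+ (s + t') = c ^+ (s' + t).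
    rewrite !exprD => h; apply/eqP; rewrite eqr_div ?expf_neq0 //; exact/eqP.
  wlog le : s t s' t' e e' / (s + t' <= s' + t)%N.
    by move=> W; case/orP: (leq_total (s + t') (s' + t)) => le;
      [apply: (W _ _ _ _ e e') | symmetry; apply: (W _ _ _ _ e' e)].
  (* The exponents [s' + t] and [s + t'] differ by a period of [x0]. *)
  rewrite -(subnKC le) [RHS]exprD [X in _ * X]per ?mulr1 //.
  apply: (@inj_iter (s + t')%N).
  rewrite -iterD subnKC // [LHS]iterD -e -iterD addnC iterD e'.
  by rewrite -iterD.
pose R x (st : nat * nat) := iter st.1 T x = iter st.2 T x0.
(* The weight is [0] at the points whose forward orbit never meets that of [x0]. *)
pose f x := match pselect (exists st, R x st) with
  | left h => c ^+ (sval (cid h)).1 / c ^+ (sval (cid h)).2 | right _ => 0 end.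
have fE x s t : iter s T x = iter t T x0 -> f x = c ^+ s / c ^+ t.
  move=> e; rewrite /f; case: pselect => [h|[]]; last by exists (s, t).
  by case: cid => -[s' t'] /= e'; apply: consist e' e.
exists f; split=> [|x|x].
- by rewrite (@fE _ 0 0) // divr1.
- have [[[s t] e]|h] := pselect (exists st, R x st).
    rewrite (fE _ _ _ e) (@fE _ s t.+1).
      by rewrite [c ^+ t.+1]exprSr invfM mulrCA [c * _]mulrCA divff // mulr1.
    by rewrite -iterSr !iterS e.
  suff [-> ->] : f x = 0 /\ f (T x) = 0 by rewrite mulr0.
  rewrite /f; split; case: pselect => // -[[s t] e]; case: h.
  by exists (s.+1, t); rewrite /R /= -e -iterSr.
by rewrite /f; case: pselect => [[[s t] e] _|_]; [exists s, t | rewrite eqxx].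
Qed.

(** * Semilinear automorphisms of the lamp group *)

Section Semilinear.
Variables (m k : nat) (S S' : 'M[int]_k) (tau : conf m k -> conf m k).
Hypotheses (m_gt0 : (0 < m)%N) (SS' : S *m S' = 1%:M).
Hypothesis tauD : {morph tau : a b / a + b}.
Hypothesis tau_shc : forall y a, tau (shc y a) = shc (y *m S) (tau a).
Implicit Types (a b d v : conf m k) (x y : Zk k).

Lemma tau0 : tau 0 = 0.
Proof. by apply: (addrI (tau 0)); rewrite -tauD !addr0. Qed.

Lemma tauN a : tau (- a) = - tau a.
Proof. by apply/eqP; rewrite -addr_eq0 -tauD addNr tau0. Qed.

Lemma tauMn a n : tau (a *+ n) = tau a *+ n.
Proof. by elim: n => [|n IHn]; rewrite ?tau0 // !mulrS tauD IHn. Qed.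

Lemma mulS_inj : injective (fun x => x *m S).
Proof.
by apply: (can_inj (g := fun x => x *m S')) => x; rewrite -mulmxA SS' mulmx1.
Qed.

Section ModP.
Variable p : nat.
Hypotheses (p_pr : prime p) (p_dvd_m : (p %| m)%N).
Local Notation u := (tau (delta m 0)).
Local Notation redp := (@red m p).

(** Both sides are additive in [a] and agree on each [delta m x]: [tau] is the substitution [S]
    followed by convolution with [u]. *)
Lemma red_tau a y :
  redp (sval (tau a) y) = funct (fun x => redp (sval u (y - x *m S))) a.
Proof.
elim/conf_ind: a => [|a b IHa IHb|x].
- by rewrite tau0 (functMn m_gt0 p_pr p_dvd_m _ 0 0) red0.
- by rewrite tauD functD // -IHa -IHb confDE redD.
by rewrite funct_delta // -[x in LHS]addr0 -shc_delta tau_shc shcE.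
Qed.

(* u is a unit of the group ring of Z^k over F_p, which has only trivial units:
   for a functional l separating supports, the extremal terms of u and of its
   inverse cannot cancel in their product. *)
Lemma unit_is_monomial v : tau v = delta m 0 ->
  exists w, redp (sval u w) != 0 /\ forall y, y != w -> redp (sval u y) = 0.
Proof.
move=> tau_v.
have red_neq0 a x : redp (sval a x) != 0 -> sval a x != 0.
  by apply: contra_neq => ->; rewrite red0.
have [s0 s0P] := proj2_sig v; have [t0 t0P] := proj2_sig u.
pose s := [seq x <- undup s0 | redp (sval v x) != 0].
pose t := [seq y <- t0 | redp (sval u y) != 0].
have sP x : (x \in s) = (redp (sval v x) != 0).
  rewrite mem_filter mem_undup; case: (boolP (redp _ != 0)) => //= vx.
  by rewrite s0P ?red_neq0.
have tP y : (y \in t) = (redp (sval u y) != 0).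
  rewrite mem_filter; case: (boolP (redp _ != 0)) => //= uy.
  by rewrite t0P ?red_neq0.
have s_uniq : uniq s by rewrite filter_uniq ?undup_uniq.
have conv y : redp (sval (delta m 0) y)
    = \sum_(x <- s) redp (sval v x) * redp (sval u (y - x *m S)).
  by have := red_tau v y; rewrite tau_v (functE _ s_uniq) // => x; rewrite sP.
have [l lB l_inj] := separating_functional (t ++ [seq x *m S | x <- s]).
have mapS x : x \in s -> x *m S \in t ++ [seq x *m S | x <- s].
  by move=> xs; rewrite mem_cat (map_f (fun x => x *m S)) ?orbT.
have l0 : l 0 = 0 by rewrite -[0 in LHS](subrr 0) lB subrr.
have lN x : l (- x) = - l x by rewrite -[- x]sub0r lB l0 sub0r.
have lD x y : l (x + y) = l x + l y by rewrite -{1}[y]opprK lB lN opprK.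
have extremal (f : Zk k -> int) : {morph f : x y / x + y} ->
    {in t ++ [seq x *m S | x <- s] &, injective f} ->
    exists2 w, w \in t & {in t, forall y, f y <= f w} /\
      {in s, forall x, f (x *m S) <= - f w}.
  move=> fD f_inj.
  have [x0 x0s x0t] : exists2 x, x \in s & - (x *m S) \in t.
    have : redp (sval (delta m 0) (0 : Zk k)) != 0.
      by rewrite deltaE eqxx red_lamp1 // oner_eq0.
    rewrite conv => /eqP nz; apply: contrapT => none; apply: nz.
    rewrite big_seq big1 // => x xs; rewrite sub0r.
    have : - (x *m S) \notin t by apply/negP => xt; apply: none; exists x.
    by rewrite tP negbK => /eqP->; rewrite mulr0.
  have [w wt wmax] := exists_maximum f x0t.
  have [x1 x1s x1max] := exists_maximum (fun x => f (x *m S)) x0s.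
  exists w => //; split=> // x xs; apply: le_trans (x1max _ xs) _.
  have f0 : f 0 = 0 by apply: (addrI (f 0)); rewrite -fD !addr0.
  have fN y : f (- y) = - f y.
    by apply/eqP; rewrite -addr_eq0 -fD addNr f0.
  (* As [f] is injective on these points, only the extremal pair [w], [x1] contributes to the
     convolution at [w + x1 *m S]; the coefficient there is nonzero, so this point is the origin. *)
  suff e : w + x1 *m S = 0 by rewrite -fN (addr0_eq e).
  have := conv (w + x1 *m S); rewrite (bigD1_seq x1) //= addrK.
  rewrite big_seq_cond big1 ?addr0 => [|x' /andP[x's ne]]; last first.
    apply/eqP; rewrite mulf_eq0; apply/orP; right.
    rewrite -[_ == 0]negbK -tP; apply: contra ne => w't.
    apply/eqP/mulS_inj/(f_inj _ _ (mapS _ x's) (mapS _ x1s))/eqP.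
    rewrite eq_le x1max //=.
    by have := wmax _ w't; rewrite !fD fN -addrA gerDl subr_le0.
  case: eqP => // _; rewrite red0 => /esym/eqP.
  by rewrite mulf_eq0 -[X in X || _]negbK -sP x1s -[_ == 0]negbK -tP wt.
have [w wt [wmax s_le]] := extremal l lD l_inj.
have [] := extremal (fun x => - l x).
- by move=> x y; rewrite lD opprD.
- by move=> x y xs ys /oppr_inj; apply: l_inj.
move=> w' w't [wmin s_ge].
have [x0 x0s] : exists x, x \in s.
  case: (s =P [::]) => [s0'|]; last first.
    by case: (s) => // x ? _; exists x; rewrite mem_head.
  by have := conv 0; rewrite s0' big_nil deltaE eqxx red_lamp1.
(* [l w] is the maximum of [l] on [t] and [l w'] the minimum, yet [- l (x0 *m S)] is at least the
   former and at most the latter. *)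
have le_ww' : l w <= l w'.
  have := s_ge _ x0s; have := s_le _ x0s; rewrite opprK => le1 le2.
  by rewrite -[l w]opprK lerNl -lerNl; apply: le_trans le2 => //; rewrite lerN2.
exists w; split=> [|y ne_yw]; first by rewrite -tP.
apply/eqP; rewrite -[_ == 0]negbK -tP; apply: contra ne_yw => yt.
apply/eqP/l_inj; rewrite ?mem_cat ?yt ?wt //; apply/eqP; rewrite eq_le wmax //=.
by apply: le_trans le_ww' _; rewrite -lerN2; apply: wmin.
Qed.

(** * The image of [1 - tau] modulo [p] *)

Definition img a := exists b d, a = b - tau b + d *+ p.

Lemma img0 : img 0.
Proof. by exists 0, 0; rewrite tau0 mul0rn subrr addr0. Qed.

Lemma imgD a b : img a -> img b -> img (a + b).
Proof.
move=> [a1 [a2 ->]] [b1 [b2 ->]]; exists (a1 + b1), (a2 + b2).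
by rewrite tauD mulrnDl opprD addrACA [a1 - _ + _]addrACA.
Qed.

Lemma imgN a : img a -> img (- a).
Proof.
move=> [a1 [a2 ->]]; exists (- a1), (- a2).
by rewrite tauN mulNrn !opprD.
Qed.

Lemma imgMn a n : img a -> img (a *+ n).
Proof.
move=> img_a; elim: n => [|n IHn]; last by rewrite mulrS; apply: imgD.
exact: img0.
Qed.

Lemma imgMp a : img (a *+ p).
Proof. by exists 0, a; rewrite tau0 subrr add0r. Qed.

(** All multiples of [p] lie in [img]; adding some to both [i] and [j] avoids subtraction of
    naturals. *)
Lemma img_congr a i j : i%:R = j%:R :> 'F_p -> img (a *+ i) -> img (a *+ j).
Proof.
move=> eq_ij img_ai.
have [q1 [q2 e]] : exists q1 q2, (j + q1 * p = i + q2 * p)%N.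
  have e n : n = (n %% p + n %/ p * p)%N by rewrite addnC -divn_eq.
  have := congr1 (@nat_of_ord _) eq_ij; rewrite !val_Fp_nat // => eq_mod.
  exists (i %/ p)%N, (j %/ p)%N; rewrite {1}[j]e {2}[i]e eq_mod.
  by rewrite -!addnA [X in (_ + X)%N]addnC.
rewrite -[a *+ j](addrK (a *+ (q1 * p))) -mulrnDr e mulrnDr !mulrnA.
by apply: imgD; [apply: imgD => //|apply: imgN]; apply: imgMp.
Qed.

Hypotheses (k_gt0 : (0 < k)%N) (detM : \det (1%:M - S) != 0).
Hypothesis tau_surj : exists v, tau v = delta m 0.
Hypothesis fin : forall f : nat -> conf m k,
  exists i j, i != j /\ exists b, f i - f j = b - tau b.

(** Hypothesis [fin] is the finiteness of the quotient by the image of [1 - tau], as a pigeonhole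
    principle. A [delta m x0] outside [img] would yield points [X j] in distinct orbits of [T], any
    two of whose deltas are separated by a [tau]-invariant functional. *)
Lemma tau_surjective_modp a : img a.
Proof.
have [v /unit_is_monomial[w [uw0 u0]]] := tau_surj.
pose T x := x *m S + w; pose n : nat := sval u w : 'I_(m.-1).+1.
pose c := redp (sval u w); have cE : c = n%:R by [].
have tau_delta x : exists d, tau (delta m x) = delta m (T x) *+ n + d *+ p.
  have [d e] : exists d, u - delta m w *+ n = d *+ p.
    apply: (red_eq0 p_pr) => y; rewrite confDE confNE confMnE deltaE.
    rewrite redD //; case: eqP => [->|/eqP/u0->].
      by rewrite lamp1K -redD // subrr.
    by rewrite mul0rn oppr0 add0r.
  exists (shc (x *m S) d).
  have shcMn y b j : shc y b *+ j = shc y (b *+ j).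
    by apply: conf_ext => z; rewrite confMnE !shcE confMnE.
  rewrite -[x in LHS]addr0 -shc_delta tau_shc -(subrK (delta m w *+ n) u) e addrC.
  by rewrite shcD -!shcMn shc_delta.
have injT : injective T by move=> x y /addIr/mulS_inj.
have img_T x s : img (delta m x - delta m (iter s T x) *+ (n ^ s)).
  elim: s => [|s IHs]; first by rewrite expn0 subrr; apply: img0.
  have [d e] := tau_delta (iter s T x).
  rewrite -[delta m x](subrK (delta m (iter s T x) *+ (n ^ s))) -addrA.
  apply: imgD => //; rewrite expnS mulrnA -mulrnBl; apply: imgMn.
  exists (delta m (iter s T x)), d; by rewrite e iterS opprD addrA addrNK.
have [H|] := pselect (forall x, img (delta m x)).
  by apply: conf_ind => [|? ?|//]; [apply: img0|apply: imgD].
move=> /existsNP[x0 Nx0]; exfalso.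
(* Otherwise [c ^+ s - 1] is invertible in ['F_p], and [img_T] along the period puts a multiple of
   [delta m x] by a unit modulo [p] into [img]. *)
have per x : ~ img (delta m x) -> forall s, iter s T x = x -> c ^+ s = 1.
  move=> Nx s sx; apply: contrapT => /eqP; rewrite -subr_eq0 => cs0; apply: Nx.
  have := img_T x s; rewrite sx.
  pose e : nat := (c ^+ s - 1)^-1 : 'F_p.
  have eE : e%:R = (c ^+ s - 1)^-1 :> 'F_p by rewrite natr_Zp.
  have N_gt0 : (0 < n ^ s)%N.
    rewrite expn_gt0 lt0n; apply/orP; left; apply: contraNneq uw0 => n0.
    by rewrite -/c cE n0.
  rewrite -(prednK N_gt0) mulrS opprD addNKr => /imgN/(imgMn e).
  rewrite opprK -mulrnA => /img_congr h; rewrite -[delta m x]mulr1n; apply: h.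
  by rewrite natrM eE -subn1 natrB // natrX -cE divff.
(* The rational fixed point of [T] is [q / D], and [V x] is [D] times the displacement of [x] from
   it, on which [T] acts as [S]. Squaring the determinant makes [D] positive. *)
pose D : int := \det (1%:M - S) ^+ 2.
have D_gt0 : 0 < D by rewrite lt_def sqr_ge0 expf_neq0.
have [q qE] : exists q, q *m (1%:M - S) = D *: w.
  exists (\det (1%:M - S) *: (w *m \adj (1%:M - S))).
  by rewrite -scalemxAl -mulmxA mul_adj_mx mul_mx_scalar scalerA.
pose V x := D *: x - q.
have VT x : V (T x) = V x *m S.
  rewrite /V /T scalerDr -qE mulmxBr mulmx1 mulmxBl -scalemxAl.
  by rewrite addrA addrAC addrK.
have V_iter s x : V (iter s T x) = iter s (fun y => y *m S) (V x).
  by elim: s => //= s IHs; rewrite VT IHs.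
have iterZ s (z : int) x :
    iter s (fun y => y *m S) (z *: x) = z *: iter s (fun y => y *m S) x.
  by elim: s => //= s ->; rewrite scalemxAl.
have content_iter s x : content (iter s (fun y => y *m S) x) = content x.
  by elim: s => //= s <-; apply: content_unimodular SS'.
have V_inj : injective V.
  by move=> x y /addIr; apply: scale_rowI; rewrite gt_eqF.
(* If [x0] is the fixed point itself, its period 1 forces [c = 1], and any other point will do. *)
have [x1 [Nx1 Vx1]] : exists x, (forall s, iter s T x = x -> c ^+ s = 1) /\ V x != 0.
  have [Vx0|] := eqVneq (V x0) 0; last by exists x0; split=> //; apply: per.
  have c1 : c = 1.
    rewrite -[c]expr1; apply: (per _ Nx0) => /=; apply: V_inj.
    by rewrite VT Vx0 mul0mx.
  exists (x0 + const_mx 1); split=> [s _|]; first by rewrite c1 expr1n.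
  rewrite -Vx0 (inj_eq V_inj) -subr_eq0 addrAC subrr add0r.
  by apply/eqP => /rowP/(_ (Ordinal k_gt0)); rewrite !mxE.
(* The image of [x1] under the homothety of ratio [1 + D * j] centred at [q / D]; it is integral
   because the ratio is 1 modulo [D]. *)
pose X (j : nat) := x1 + j%:Z *: V x1.
pose d (j : nat) : nat := (1 + `|D| * j)%N.
have VX j : V (X j) = (d j)%:Z *: V x1.
  rewrite /V /X scalerDr addrAC -/(V x1) scalerA PoszD scalerDl scale1r PoszM.
  by rewrite gtz0_abs.
have d_neq0 j : (d j)%:Z != 0 by [].
have perX j s : iter s T (X j) = X j -> c ^+ s = 1.
  move=> sX; apply: Nx1; apply/V_inj/(scale_rowI (d_neq0 j)).
  by rewrite V_iter -iterZ -VX -V_iter sX.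
have X_orbits i j s t : iter s T (X i) = iter t T (X j) -> i = j.
  move=> /(congr1 (fun x => content (V x))) /=; rewrite !V_iter !content_iter !VX.
  rewrite !content_scale => /eqP; rewrite eqn_mul2r => /orP[/eqP/content_eq0/eqP|].
    by rewrite (negPf Vx1).
  by rewrite eqn_add2l eqn_mul2l absz_eq0 gt_eqF //= => /eqP.
have [i [j [ne_ij [b e]]]] := fin (fun j => delta m (X j)).
have [f [f1 fT f_orbit]] := orbit_weight injT uw0 (perX i).
have fj0 : f (X j) = 0.
  apply/eqP/negP => /negP/f_orbit[s [t /X_orbits eq_ji]].
  by rewrite eq_ji eqxx in ne_ij.
(* By [fT] the functional is [tau]-invariant, so it kills [b - tau b]; but it is 1 on the delta at
   [X i] and 0 on the delta at [X j]. *)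
have fun_tau b' : funct f (tau b') = funct f b'.
  elim/conf_ind: b' => [|b1 b2 IHa IHa'|x]; first by rewrite tau0.
    by rewrite tauD !functD // IHa IHa'.
  have [d' ->] := tau_delta x; rewrite functD // functMn // functMp // addr0.
  by rewrite !funct_delta // [RHS]fT -mulr_natl.
have := congr1 (funct f) e; rewrite !functD // !functN // fun_tau subrr.
by rewrite !funct_delta // f1 fj0 subr0 => /eqP; rewrite oner_eq0.
Qed.

End ModP.

Hypotheses (k_gt0 : (0 < k)%N) (detM : \det (1%:M - S) != 0).
Hypothesis tau_surj : exists v, tau v = delta m 0.
Hypothesis fin : forall f : nat -> conf m k,
  exists i j, i != j /\ exists b, f i - f j = b - tau b.

(** Induction on the divisors [N] of [m]: with [p] a prime factor of [N], an error divisible by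
    [N / p] is corrected modulo [p] to one divisible by [N]. At [N = m] the error vanishes. *)
Theorem sub_tau_surjective a : exists b, a = b - tau b.
Proof.
suff H N : (0 < N)%N -> (N %| m)%N -> forall a, exists b d, a = b - tau b + d *+ N.
  have [b [d ->]] := H m m_gt0 (dvdnn m) a.
  by exists b; rewrite confMm // addr0.
elim/ltn_ind: N => N IHN N_gt0 N_m {}a; have [N1|N_gt1|N1] := ltngtP N 1.
- by case: N N1 N_gt0 {IHN N_m}.
- have p_N := pdiv_dvd N; have p_pr := pdiv_prime N_gt1.
  have [|||b [d ->]] := IHN (N %/ pdiv N)%N _ _ _ a.
  + by rewrite ltn_Pdiv ?prime_gt1.
  + by rewrite divn_gt0 ?prime_gt0 // dvdn_leq.
  + by apply: dvdn_trans N_m; apply: dvdn_div.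
  have [b' [d' ->]] := tau_surjective_modp p_pr (dvdn_trans p_N N_m) k_gt0 detM
    tau_surj fin d.
  exists (b + b' *+ (N %/ pdiv N)), d'.
  rewrite tauD tauMn !mulrnDl mulNrn -mulrnA mulnC divnK // opprD addrA.
  by rewrite addrACA.
by exists 0, a; rewrite tau0 subrr add0r N1.
Qed.

End Semilinear.

(** * Characters of a finite quotient of Z^k *)

Lemma exists_primitive_root (C : numClosedFieldType) n :
  (0 < n)%N -> exists z : C, n.-primitive_root z.
Proof.
pose p : {poly C} := 'X^n - 1; have [r Dp] := closed_field_poly_normal p.
move=> n_gt0; rewrite (monicP _) ?monicXnsubC // scale1r in Dp.
have rn1 : all n.-unity_root r.
  by apply/allP => z; rewrite -root_prod_XsubC -Dp.
have sz_r : (n < (size r).+1)%N.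
  by rewrite -(size_prod_XsubC r id) -Dp size_XnsubC.
have [|z] := hasP (has_prim_root n_gt0 rn1 _ sz_r); last by exists z.
by rewrite -separable_prod_XsubC -Dp separable_Xn_sub_1 // pnatr_eq0 -lt0n.
Qed.

Section MultiplicativeFunction.
Variables (k : nat) (F : fieldType) (f : 'rV[int]_k -> F).
Hypotheses (fD : forall x y, f (x + y) = f x * f y) (f0 : f 0 = 1).

Lemma mfun_neq0 x : f x != 0.
Proof.
apply/eqP => fx0; have := oner_neq0 F.
by rewrite -f0 -(subrr x) fD fx0 mul0r eqxx.
Qed.

Lemma mfunN x : f (- x) = (f x)^-1.
Proof.
by apply: (mulfI (mfun_neq0 x)); rewrite -fD subrr f0 mulfV ?mfun_neq0.
Qed.

Lemma mfunZ (z : int) x : f (z *: x) = f x ^ z.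
Proof.
have fMn (n : nat) : f (n%:Z *: x) = f x ^+ n.
  elim: n => [|n IHn]; first by rewrite scale0r f0.
  by rewrite intS scalerDl scale1r fD IHn exprS.
case: z => n; first exact: fMn.
by rewrite NegzE scaleNr mfunN fMn -exprnN.
Qed.

Lemma mfun_sum (I : finType) (g : I -> 'rV[int]_k) :
  f (\sum_i g i) = \prod_i f (g i).
Proof. exact: (big_morph f fD f0). Qed.

End MultiplicativeFunction.

(** The Smith form [M = L *m D *m R] turns the quotient into a product of cyclic groups of orders
    |d_i|. Tuples in [X] index both the cosets, through [F], and the characters: [chi x] sends row
    [i] of [R] to [w i ^+ x i], with [w i] a primitive root of unity of order |d_i|. *)
Lemma dual_of_quotient (C : numClosedFieldType) k (M : 'M[int]_k) :
  \det M != 0 ->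
  exists (X : finType) (F : X -> 'rV[int]_k) (chi : X -> 'rV[int]_k -> C),
  [/\ forall x x' y, F x - F x' = y *m M -> x = x',
      forall z, exists x y, z - F x = y *m M,
      forall x x', chi x =1 chi x' -> x = x',
      forall x, [/\ forall z z', chi x (z + z') = chi x z * chi x z',
                    forall y, chi x (y *m M) = 1 & forall z, `|chi x z| = 1] &
      forall f, (forall z z', f (z + z') = f z * f z') ->
        (forall y, f (y *m M) = 1) -> exists x, f =1 chi x].
Proof.
move=> detM; have [L Lu [R Ru [d _ MD]]] := int_Smith_normal_form M.
set D := \matrix_(i, j) _ in MD.
have mulD (y : 'rV_k) i : (y *m D) 0 i = y 0 i * d`_i.
  rewrite mxE (bigD1 i) //= big1 => [|j ne_ji]; last first.
    by rewrite mxE -val_eqE in ne_ji *; rewrite (negPf ne_ji) mulr0.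
  by rewrite mxE eqxx addr0.
(* If d_i were zero, row [i] of [invmx L] would be a left null vector of [M]. *)
have d0 (i : 'I_k) : d`_i != 0.
  apply: contraNneq detM => di0; apply/det0P.
  exists (delta_mx 0 i *m invmx L).
    apply/eqP => /(congr1 (mulmx^~ L)); rewrite mulmxKV // mul0mx.
    by move/rowP/(_ i); rewrite !mxE !eqxx.
  rewrite MD -mulmxA -mulmxA mulKmx // mulmxA.
  suff -> : delta_mx (0 : 'I_1) i *m D = 0 by rewrite mul0mx.
  apply/rowP => j; rewrite mulD !mxE /=; case: eqP => [->|]; rewrite ?mul0r //.
  by rewrite di0 mulr0.
pose N (i : 'I_k) := `|(d`_i)%R|%N.
have N_gt0 i : (0 < N i)%N by rewrite absz_gt0.
have /fin_all_exists[w w_prim] i : exists w : C, (N i).-primitive_root w.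
  exact: exists_primitive_root.
have w0 i : w i != 0.
  apply/eqP => wi0; have := prim_expr_order (w_prim i).
  by rewrite wi0 expr0n gtn_eqF // => /esym/eqP; rewrite oner_eq0.
pose X := {dffun forall i : 'I_k, 'I_(N i)}.
pose F (x : X) := \row_i (x i : nat)%:Z *m R.
pose chi (x : X) (z : 'rV_k) := \prod_i (w i ^+ x i) ^ (z *m invmx R) 0 i.
have chiD x z z' : chi x (z + z') = chi x z * chi x z'.
  rewrite /chi -big_split; apply: eq_bigr => i _.
  by rewrite mulmxDl mxE expfzDr ?expf_neq0.
have w_d i : w i ^ d`_i = 1.
  have := prim_expr_order (w_prim i); rewrite exprnP /N abszE.
  by case: (ger0P d`_i) => // _ e; apply: invr_inj; rewrite invr_expz e invr1.
have chiM x y : chi x (y *m M) = 1.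
  rewrite /chi big1 // => i _; rewrite MD !mulmxA mulmxK // mulD mulrC.
  by rewrite exprnP !exprz_exp mulrCA -exprz_exp w_d exp1rz.
have chi_norm x z : `|chi x z| = 1.
  have w1 i : `|w i| = 1.
    apply/eqP; rewrite -(@pexpr_eq1 _ _ (N i)) // -normrX.
    by rewrite (prim_expr_order (w_prim i)) normr1.
  rewrite normr_prod big1 // => i _.
  have wx1 : `|w i ^+ x i| = 1 by rewrite normrX w1 expr1n.
  case: (fun_of_matrix _ _ _) => n; first by rewrite normrX wx1 expr1n.
  by rewrite NegzE -exprnN normfV normrX wx1 expr1n invr1.
have delta_coord (z : 'rV[int]_k) :
    z = \sum_i (z *m invmx R) 0 i *: (delta_mx 0 i *m R).
  rewrite -{1}(mulmxKV Ru z) {1}[z *m _]row_sum_delta mulmx_suml.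
  by under eq_bigr do rewrite -scalemxAl.
exists X, F, chi; split=> [x x' y|z|x x' eq_chi||f fD fM].
- rewrite -mulmxBl MD mulmxA => /(can_inj (mulmxK Ru)) e; apply/ffunP => i.
  have := congr1 (fun v : 'rV_k => v 0 i) e; rewrite mulmxA mulD !mxE => {}e.
  have small (x0 : X) : ((x0 i : nat) %% d`_i)%Z = x0 i.
    by rewrite -modz_abs modz_small //=; apply: ltn_ord.
  apply: val_inj; apply/eqP; rewrite -eqz_nat -small -[X in _ == X]small.
  by rewrite eqz_mod_dvd e dvdz_mull.
- have [A ->] : exists A, z = A *m R by exists (z *m invmx R); rewrite mulmxKV.
  pose t i := A 0 i.
  have tN i : (absz (t i %% d`_i)%Z < N i)%N.
    by rewrite -ltz_nat gez0_abs ?modz_ge0 // abszE ltz_mod.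
  pose x : X := [ffun i => Ordinal (tN i)].
  exists x, (\row_i (t i %/ d`_i)%Z *m invmx L).
  rewrite -mulmxBl MD mulmxA; congr (_ *m R).
  rewrite mulmxA mulmxKV //; apply/rowP => i; rewrite mulD !mxE ffunE /=.
  rewrite gez0_abs ?modz_ge0 // -/(t i) {1}(divz_eq (t i) d`_i).
  by rewrite addrK.
- apply/ffunP => i; have := eq_chi (delta_mx 0 i *m R).
  have chi_delta (x0 : X) : chi x0 (delta_mx 0 i *m R) = w i ^+ x0 i.
    rewrite /chi mulmxK // (bigD1 i) //= mxE !eqxx big1 ?mulr1 // => j ne_ji.
    by rewrite mxE (negPf ne_ji) andbF.
  rewrite !chi_delta => /eqP; rewrite (eq_prim_root_expr (w_prim i)).
  by rewrite !modn_small // => /eqP/val_inj.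
- by split.
have f0 : f 0 = 1 by rewrite -(mul0mx _ M) fM.
(* Row [i] of [R] times d_i is row [i] of [invmx L] times [M], where [f] is 1; so [f] takes a root
   of unity of order dividing |d_i| at row [i] of [R]. *)
have /fin_all_exists[y fy] i : exists y : 'I_(N i), f (delta_mx 0 i *m R) = w i ^+ y.
  have fd : f (delta_mx 0 i *m R) ^ d`_i = 1.
    rewrite -mfunZ // -(fM (delta_mx 0 i *m invmx L)); congr f.
    rewrite MD !mulmxA mulmxKV // scalemxAl; congr (_ *m R).
    apply/rowP => j; rewrite mulD !mxE /= mulrC; case: eqP => [->//|].
    by rewrite !mul0r.
  have /(prim_rootP (w_prim i))[y ->] : f (delta_mx 0 i *m R) ^+ N i = 1.
    rewrite exprnP abszE; case: (ger0P d`_i) => // _.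
    by rewrite -invr_expz fd invr1.
  by exists y.
exists [ffun i => y i] => z.
rewrite {1}[z]delta_coord mfun_sum //; apply: eq_bigr => i _.
by rewrite mfunZ // fy ffunE.
Qed.

(** * Subspaces and eigenvectors *)

(** While [K] has a vector outside the row space of [U], that vector is added to [U]; the rank is at
    most [d], so this stops. *)
Lemma subspace_mx (F : fieldType) d (K : 'rV[F]_d -> Prop) :
  K 0 -> (forall u v, K u -> K v -> K (u + v)) ->
  (forall c v, K v -> K (c *: v)) ->
  exists U : 'M_d, forall v, K v <-> (v <= U)%MS.
Proof.
move=> K0 KD KZ.
suff H n (U : 'M_d) : (d - \rank U < n)%N -> (forall v, (v <= U)%MS -> K v) ->
    exists U' : 'M_d, forall v, K v <-> (v <= U')%MS.
  by apply: (H _ 0 (ltnSn _)) => v; rewrite submx0 => /eqP->.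
elim: n U => // n IHn U rkU UK.
have [H|/existsNP[v /not_implyP[Kv /negP vU]]] :=
  pselect (forall v, K v -> (v <= U)%MS).
  by exists U => v; split; [apply: H|apply: UK].
apply: (IHn (U + v)%MS) => [|w /sub_addsmxP[[a b] ->]]; last first.
  apply: KD; first by apply: UK; apply: submxMl.
  by rewrite [b]mx11_scalar mul_scalar_mx; apply: KZ.
have lt : (\rank U < \rank (U + v)%MS)%N.
  apply: rank_ltmx; rewrite /ltmx addsmxSl /=.
  by apply: contra vU; apply: submx_trans; apply: addsmxSr.
by have := rank_leq_row (U + v)%MS; lia.
Qed.

(** Descent on the rank of a nonzero invariant space [W]: if some [A] is not scalar on [W], an
    eigenspace of [A] meets [W] in a smaller nonzero space, invariant because the family
    commutes. *)
Lemma family_common_eigenvector (C : numClosedFieldType) d (K : 'M[C]_d -> Prop) :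
  (0 < d)%N -> (forall A B, K A -> K B -> A *m B = B *m A) ->
  exists2 v : 'rV_d, v != 0 & forall A, K A -> exists c, v *m A = c *: v.
Proof.
move=> d_gt0 commK.
suff H n (W : 'M[C]_d) : (\rank W <= n)%N -> W != 0 ->
    (forall A, K A -> (W *m A <= W)%MS) ->
    exists2 v : 'rV_d, v != 0 & forall A, K A -> exists c, v *m A = c *: v.
  apply: (H _ 1%:M (leqnn _)) => [|A _]; last exact: submx1.
  by rewrite -mxrank_eq0 mxrank1 -lt0n.
elim: n W => [|n IHn] W; first by rewrite leqn0 mxrank_eq0 => ->.
move=> rkW W0 invW.
have [scal|/existsNP[A /not_implyP[KA nA]]] :=
  pselect (forall A, K A -> exists c, W *m A = c *: W).
  exists (nz_row W); first by rewrite nz_row_eq0.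
  move=> A /scal[c WA]; exists c; have /submxP[D ->] := nz_row_sub W.
  by rewrite -mulmxA WA scalemxAr.
have /submxP[X BA] : (row_base W *m A <= row_base W)%MS.
  by rewrite (eqmxMr _ (eq_row_base W)) eq_row_base invW.
have [|c /eigenvalueP[v vX v0]] := @eigenvalue_closed C _ X.
  by rewrite lt0n mxrank_eq0.
pose W' := (W :&: eigenspace A c)%MS.
have vB0 : v *m row_base W != 0.
  by rewrite mulmx_free_eq0 ?row_base_free.
apply: (IHn W') => [|| A' KA'].
- rewrite -ltnS; apply: leq_trans rkW; apply: rank_ltmx.
  rewrite /ltmx capmxSl /=; apply/negP => le_W; apply: nA; exists c.
  by apply/eigenspaceP; apply: submx_trans le_W (capmxSr _ _).
- apply: contraNneq vB0 => W'0; rewrite -submx0 -W'0 sub_capmx.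
  rewrite (submx_trans (submxMl _ _)) ?eq_row_base //=.
  by apply/eigenspaceP; rewrite -mulmxA BA mulmxA vX scalemxAl.
rewrite sub_capmx (submx_trans (submxMr _ (capmxSl _ _))) ?invW //=.
apply/eigenspaceP; rewrite -mulmxA -(commK _ _ KA KA') mulmxA.
by have /eigenspaceP -> := capmxSr W (eigenspace A c); rewrite scalemxAl.
Qed.

(** * The standard Hermitian product *)

Section Dot.
Variable d : nat.
Implicit Types u v w : 'rV[CC]_d.

Definition dot u v : CC := (u *m adjmx v) 0 0.

Lemma dotE u v : dot u v = \sum_i u 0 i * (v 0 i)^*.
Proof. by rewrite /dot mxE; apply: eq_bigr => i _; rewrite !mxE. Qed.

Lemma dotD u v w : dot (u + v) w = dot u w + dot v w.
Proof. by rewrite /dot mulmxDl mxE. Qed.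

Lemma dotZ c u v : dot (c *: u) v = c * dot u v.
Proof. by rewrite /dot -scalemxAl mxE. Qed.

Lemma dotZr c u v : dot u (c *: v) = c^* * dot u v.
Proof.
rewrite !dotE mulr_sumr; apply: eq_bigr => i _.
by rewrite mxE rmorphM mulrCA.
Qed.

Lemma dot_eq0 v : dot v v = 0 -> v = 0.
Proof.
rewrite dotE => /eqP; rewrite psumr_eq0 => [/allP v0|i _]; last exact: mul_conjC_ge0.
apply/rowP => i; rewrite mxE; apply/eqP; rewrite -mul_conjC_eq0.
exact: (v0 i (mem_index_enum i)).
Qed.

Lemma adjmxM p q r (A : 'M[CC]_(p, q)) (B : 'M[CC]_(q, r)) :
  adjmx (A *m B) = adjmx B *m adjmx A.
Proof. by rewrite /adjmx map_mxM trmx_mul. Qed.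

Lemma adjmx_scalar p (c : CC) : adjmx (c%:M : 'M_p) = (c^*)%:M.
Proof. by rewrite /adjmx map_scalar_mx tr_scalar_mx. Qed.

Lemma dot_unitary (U : 'M[CC]_d) u v :
  unitary_mx U -> dot (u *m U) (v *m U) = dot u v.
Proof. by case=> UU _; rewrite /dot adjmxM mulmxA -(mulmxA u) UU mulmx1. Qed.

End Dot.

(** * Automorphisms and Reidemeister classes of the wreath product *)

Lemma additive_rowE k l (f : 'rV[int]_k -> 'rV[int]_l) :
  {morph f : x y / x + y} -> forall x, f x = x *m \matrix_i f (delta_mx 0 i).
Proof.
move=> fD; have f0 : f 0 = 0 by apply: (addrI (f 0)); rewrite -fD !addr0.
have fN x : f (- x) = - f x by apply/eqP; rewrite -addr_eq0 -fD addNr f0.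
have fMn x (n : nat) : f (n%:Z *: x) = n%:Z *: f x.
  elim: n => [|n IHn]; first by rewrite !scale0r.
  by rewrite intS !scalerDl !scale1r fD IHn.
have fZ (z : int) x : f (z *: x) = z *: f x.
  by case: z => n //; rewrite NegzE !scaleNr fN fMn.
move=> x; rewrite {1}[x]row_sum_delta (big_morph f fD f0) mulmx_sum_row.
by apply: eq_bigr => i _; rewrite fZ rowK.
Qed.

Section Wreath.
Variables m k : nat.
Implicit Types (a b c : conf m k) (x y z : Zk k) (g h : wr m k).

Definition emb a z : wr m k := exist _ (sval a, z) (proj2_sig a).
Definition lam g : conf m k := exist _ (sval g).1 (proj2_sig g).
Definition pr g : Zk k := (sval g).2.

Lemma wr_ext g h : lam g = lam h -> pr g = pr h -> g = h.
Proof.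
case: g h => [[a y] /= fa] [[b z] /= fb].
by rewrite /lam /pr /= => -[ab] yz; subst; congr exist; apply: Prop_irrelevance.
Qed.

Lemma lam_emb a z : lam (emb a z) = a. Proof. exact: conf_ext. Qed.
Lemma pr_emb a z : pr (emb a z) = z. Proof. by []. Qed.
Lemma embK g : emb (lam g) (pr g) = g.
Proof. by apply: wr_ext; rewrite ?lam_emb. Qed.

Lemma lamM g h : lam (wr_mul g h) = lam g + shc (pr g) (lam h).
Proof. exact: conf_ext. Qed.
Lemma prM g h : pr (wr_mul g h) = pr g + pr h. Proof. by []. Qed.

Lemma emb_mul a y b z : wr_mul (emb a y) (emb b z) = emb (a + shc y b) (y + z).
Proof. by apply: wr_ext; rewrite ?lamM ?lam_emb. Qed.

Lemma emb_split a y : emb a y = wr_mul (emb a 0) (emb 0 y).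
Proof. by rewrite emb_mul shc0 addr0 add0r. Qed.

Lemma wr_mulA g h l : wr_mul g (wr_mul h l) = wr_mul (wr_mul g h) l.
Proof. by apply: wr_ext; rewrite ?lamM ?prM ?addrA // shcD shc_shc addrA. Qed.

Lemma wr_mul1 g : wr_mul g (wr_one m k) = g.
Proof.
apply: wr_ext; last by rewrite prM; apply: addr0.
rewrite lamM; apply: conf_ext => x; rewrite confDE shcE; exact: addr0.
Qed.

Lemma wr_mulV g : wr_mul g (wr_inv g) = wr_one m k.
Proof.
apply: wr_ext; last exact: subrr.
apply: conf_ext => x; rewrite lamM confDE shcE /= /shiftc opprK.
by rewrite -/(pr g) subrK subrr.
Qed.

Lemma wr_mul1g g : wr_mul (wr_one m k) g = g.
Proof.
apply: wr_ext; last by rewrite prM; apply: add0r.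
by rewrite lamM; apply: conf_ext => x; rewrite confDE shcE; rewrite subr0; apply: add0r.
Qed.

Lemma wr_mulVg g : wr_mul (wr_inv g) g = wr_one m k.
Proof.
rewrite -[LHS]wr_mul1 -(wr_mulV (wr_inv g)) !wr_mulA -(wr_mulA (wr_inv g)).
by rewrite wr_mulV wr_mul1.
Qed.

Lemma wr_mulI g : injective (wr_mul g).
Proof.
by move=> h l e; rewrite -[h]wr_mul1g -[l]wr_mul1g -(wr_mulVg g) -!wr_mulA e.
Qed.

Lemma wr_one_emb : wr_one m k = emb 0 0.
Proof. by apply: wr_ext => //; apply: conf_ext. Qed.

Section Hom.
Variable phi : wr m k -> wr m k.
Hypotheses (m_gt0 : (0 < m)%N)
  (phiM : forall g h, phi (wr_mul g h) = wr_mul (phi g) (phi h)).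

Lemma hom1 : phi (wr_one m k) = wr_one m k.
Proof. by apply: (@wr_mulI (phi (wr_one m k))); rewrite -phiM !wr_mul1. Qed.

Lemma homV g : phi (wr_inv g) = wr_inv (phi g).
Proof. by apply: (@wr_mulI (phi g)); rewrite -phiM !wr_mulV hom1. Qed.

Definition hom_lamp a := lam (phi (emb a 0)).
Definition hom_mx : 'M[int]_k := \matrix_i pr (phi (emb 0 (delta_mx 0 i))).

(* The lamp group is the torsion subgroup, hence characteristic. *)
Lemma pr_hom_lamp a : pr (phi (emb a 0)) = 0.
Proof.
have hD a' b : pr (phi (emb (a' + b) 0)) = pr (phi (emb a' 0)) + pr (phi (emb b 0)).
  by rewrite -prM -phiM emb_mul shc0 addr0.
have h0 : pr (phi (emb 0 0)) = 0 by rewrite -wr_one_emb hom1.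
have hMn n : pr (phi (emb (a *+ n) 0)) = pr (phi (emb a 0)) *+ n.
  by elim: n => [|n IHn]; rewrite ?h0 // !mulrS hD IHn.
have := hMn m; rewrite confMm // h0 => /esym/rowP am0; apply/rowP => i.
by have := am0 i; rewrite mulmxnE !mxE => /eqP; rewrite mulrn_eq0 gtn_eqF //= => /eqP.
Qed.

Lemma hom_lampE a : phi (emb a 0) = emb (hom_lamp a) 0.
Proof. by rewrite -[LHS]embK pr_hom_lamp. Qed.

Lemma pr_hom g : pr (phi g) = pr g *m hom_mx.
Proof.
rewrite -[g in LHS]embK emb_split phiM prM pr_hom_lamp add0r.
apply: (additive_rowE (f := fun z => pr (phi (emb 0 z)))) => x y.
rewrite -prM -phiM emb_mul; congr (pr (phi (emb _ _))).
by apply: conf_ext => z; rewrite confDE shcE addr0.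
Qed.

Lemma hom_lampD : {morph hom_lamp : a b / a + b}.
Proof.
move=> a b; rewrite /hom_lamp.
have -> : emb (a + b) 0 = wr_mul (emb a 0) (emb b 0) by rewrite emb_mul shc0 addr0.
by rewrite phiM lamM pr_hom_lamp shc0.
Qed.

(** Apply [phi] to the relation saying that conjugation by [y] shifts the lamps by [y]. *)
Lemma hom_lamp_shc y b : hom_lamp (shc y b) = shc (y *m hom_mx) (hom_lamp b).
Proof.
have e : wr_mul (emb 0 y) (emb b 0) = wr_mul (emb (shc y b) 0) (emb 0 y).
  rewrite !emb_mul add0r addr0 add0r; congr emb.
  by apply: conf_ext => x; rewrite confDE shcE addr0.
have /(congr1 lam) := congr1 phi e.
rewrite !phiM !lamM pr_hom pr_emb pr_hom_lamp shc0 [RHS]addrC.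
by move/addrI.
Qed.

End Hom.

Lemma hom_mx_can phi psi : (0 < m)%N ->
  (forall g h, phi (wr_mul g h) = wr_mul (phi g) (phi h)) ->
  (forall g h, psi (wr_mul g h) = wr_mul (psi g) (psi h)) ->
  cancel phi psi -> hom_mx phi *m hom_mx psi = 1%:M.
Proof.
move=> m_gt0 phiM psiM phiK; apply/row_matrixP => i; rewrite !rowE mulmx1 mulmxA.
by rewrite -[delta_mx _ _ in LHS](pr_emb 0) -!pr_hom // phiK.
Qed.

Section Reidemeister.
Variables (phi : wr m k -> wr m k) (n : nat).
Hypotheses (m_gt0 : (0 < m)%N) (k_gt0 : (0 < k)%N)
  (aut_phi : is_automorphism phi) (num_n : num_classes (reid_rel phi) n).
Local Notation S := (hom_mx phi).

Let phiM : forall g h, phi (wr_mul g h) = wr_mul (phi g) (phi h).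
Proof. by case: aut_phi. Qed.

Lemma reid_relE g g' :
  reid_rel phi g g' <-> exists h, wr_mul g' (phi h) = wr_mul h g.
Proof.
split=> -[h e]; exists h.
  by rewrite e homV // -wr_mulA wr_mulVg wr_mul1.
by rewrite -e homV // -wr_mulA wr_mulV wr_mul1.
Qed.

Lemma reid_rel_sym g g' : reid_rel phi g g' -> reid_rel phi g' g.
Proof.
move=> /reid_relE[h e]; apply/reid_relE; exists (wr_inv h).
apply: (@wr_mulI h); rewrite !wr_mulA -e wr_mulV wr_mul1g.
by rewrite homV // -wr_mulA wr_mulV wr_mul1.
Qed.

Lemma reid_rel_trans g g' g'' :
  reid_rel phi g g' -> reid_rel phi g' g'' -> reid_rel phi g g''.
Proof.
move=> /reid_relE[h e] /reid_relE[h' e']; apply/reid_relE; exists (wr_mul h' h).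
by rewrite phiM wr_mulA e' -wr_mulA e wr_mulA.
Qed.

Lemma reid_pigeonhole (F : nat -> wr m k) :
  exists i j, i != j /\ reid_rel phi (F i) (F j).
Proof.
have [f [_ f_surj]] := num_n.
have /fin_all_exists[c cP] (i : 'I_n.+1) : exists j, reid_rel phi (F i) (f j).
  exact: f_surj.
have /injectivePn[i [j ne_ij eq_c]] : ~~ injectiveb c.
  apply/injectiveP => /leq_card; by rewrite !card_ord ltnn.
exists (i : nat), (j : nat); split=> //; apply: reid_rel_trans (cP i) _.
by rewrite eq_c; apply: reid_rel_sym.
Qed.

Lemma reid_rel_pr g g' :
  reid_rel phi g g' -> exists y, pr g' - pr g = y *m (1%:M - S).
Proof.
move=> /reid_relE[h /(congr1 pr)]; rewrite !prM pr_hom // => e; exists (pr h).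
rewrite mulmxBr mulmx1; apply/eqP; rewrite subr_eq addrAC -e addrK //.
Qed.

(** A nonzero [v] with [(1 - S) v^T = 0] would give a function [x v^T] of the projection [x],
    constant on classes by [reid_rel_pr] but with distinct values at the multiples of [v]. *)
Lemma det_neq0 : \det (1%:M - S) != 0.
Proof.
rewrite -det_tr; apply/negP => /det0P[v v0].
move=> /(congr1 trmx); rewrite trmx_mul trmxK trmx0 => Mv.
have [i [j [ne_ij /reid_rel_pr[y]]]] := reid_pigeonhole (fun i => emb 0 (i%:Z *: v)).
rewrite !pr_emb -scalerBl => /(congr1 (fun u => (u *m v^T) 0 0)).
rewrite -mulmxA Mv mulmx0 -scalemxAl [RHS]mxE mxE => /eqP.
rewrite mulf_eq0 subr_eq0 eqz_nat eq_sym (negPf ne_ij) /= mxE.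
under eq_bigr do rewrite mxE -expr2.
rewrite psumr_eq0 => [/allP v_eq0|l _]; last exact: sqr_ge0.
case/eqP: v0; apply/rowP => l; rewrite mxE; apply/eqP.
by have := v_eq0 l (mem_index_enum l); rewrite /= sqrf_eq0.
Qed.

Lemma mulM_eq0 y : y *m (1%:M - S) = 0 -> y = 0.
Proof.
by move=> yM; apply: contraNeq det_neq0 => y0; apply/det0P; exists y.
Qed.

(** Twisted conjugation by lamps [b] adds [b - fiber_map z b] to the lamps of an element over
    [z]. *)
Definition fiber_map z b := shc z (hom_lamp phi b).

Lemma fiber_map_surjective z a : exists b, a = b - fiber_map z b.
Proof.
have [[psi phiK psiK] _] := aut_phi.
have psiM g h : psi (wr_mul g h) = wr_mul (psi g) (psi h).
  by apply: (can_inj phiK); rewrite phiM !psiK.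
apply: (@sub_tau_surjective _ _ S (hom_mx psi)) => //.
- exact: hom_mx_can.
- by move=> b c; rewrite /fiber_map hom_lampD // shcD.
- by move=> y b; rewrite /fiber_map hom_lamp_shc // !shc_shc addrC.
- exact: det_neq0.
- exists (hom_lamp psi (shc (- z) (delta m 0))).
  rewrite /fiber_map {1}/hom_lamp -hom_lampE // psiK lam_emb shc_shc subrr.
  exact: shc0.
move=> f; have [i [j [ne_ij /reid_relE[h e]]]] :=
  reid_pigeonhole (fun i => emb (f i) z).
exists j, i; split; first by rewrite eq_sym.
(* The conjugating element fixes the projection [z], so it lies over 0 by injectivity of [1 - S] and
   consists of lamps only. *)
have h0 : pr h = 0.
  apply: mulM_eq0; have := congr1 pr e; rewrite !prM pr_hom // !pr_emb.
  by rewrite addrC mulmxBr mulmx1 => /addIr ->; rewrite subrr.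
exists (lam h); have := congr1 lam e.
rewrite -[h in phi h]embK h0 hom_lampE // !lamM !lam_emb h0 shc0 -/(fiber_map z _).
by move=> e'; apply/eqP; rewrite subr_eq addrAC -e' addrK.
Qed.

(** For the converse, a conjugating element over [y] matches the projections, and
    [fiber_map_surjective] supplies its lamps [b]. *)
Lemma reid_rel_prP g g' :
  reid_rel phi g g' <-> exists y, pr g' - pr g = y *m (1%:M - S).
Proof.
split=> [|[y e]]; first exact: reid_rel_pr.
have [b be] := fiber_map_surjective (pr g')
  (lam g' + shc (pr g') (lam (phi (emb 0 y))) - shc y (lam g)).
apply/reid_relE; exists (emb b y); rewrite (emb_split b) phiM hom_lampE //.
apply: wr_ext.
  rewrite !lamM !lam_emb prM !pr_emb shc0 shcD -/(fiber_map _ _) add0r.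
  rewrite shc0 addr0 [fiber_map _ _ + _]addrC addrA.
  have := congr1 (fun c => c + shc y (lam g) + fiber_map (pr g') b) be.
  by rewrite subrK => ->; rewrite addrAC subrK.
rewrite !prM pr_hom // !pr_emb !add0r.
move/eqP: e; rewrite subr_eq mulmxBr mulmx1 => /eqP->.
by rewrite addrAC addrNK.
Qed.

End Reidemeister.
End Wreath.

(** * Fixed representations *)

Section FixedRepresentation.
Variables (m k n d : nat) (phi : wr m k -> wr m k).
Hypotheses (m_gt0 : (0 < m)%N) (k_gt0 : (0 < k)%N)
  (aut_phi : is_automorphism phi) (num_n : num_classes (reid_rel phi) n).
Variables (r : wr m k -> 'M[CC]_d) (P : 'M[CC]_d).
Hypotheses (d_gt0 : (0 < d)%N) (r_unitary : forall g, unitary_mx (r g))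
  (rM : forall g h, r (wr_mul g h) = r g *m r h)
  (r_irr : forall U : 'M[CC]_d, (forall g, (U *m r g <= U)%MS) ->
    \rank U = 0%N \/ \rank U = d)
  (PP : P *m adjmx P = 1%:M) (rP : forall g, r (phi g) *m P = P *m r g).
Local Notation A a := (r (emb a 0)).

Lemma rep1 : r (wr_one m k) = 1%:M.
Proof.
have [_ rV] := r_unitary (wr_one m k).
by rewrite -[LHS]mul1mx -rV -mulmxA -rM wr_mul1.
Qed.

Lemma irr_subspace (K : 'rV[CC]_d -> Prop) :
  K 0 -> (forall u v, K u -> K v -> K (u + v)) ->
  (forall c v, K v -> K (c *: v)) -> (forall v g, K v -> K (v *m r g)) ->
  (exists2 v, v != 0 & K v) -> forall v, K v.
Proof.
move=> K0 KD KZ Kr [v v0 Kv]; have [U UE] := subspace_mx K0 KD KZ.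
have Uinv g : (U *m r g <= U)%MS.
  by apply/row_subP => i; rewrite row_mul; apply/UE/Kr/UE/row_sub.
case: (r_irr Uinv) => [/eqP|rkU w].
  rewrite mxrank_eq0 => /eqP U0; move/UE: Kv; rewrite U0 submx0.
  by rewrite (negPf v0).
by apply/UE; rewrite submx_full // /row_full rkU.
Qed.

(** The commuting unitaries [A b] have a common eigenvector [v], with character [chi]. Comparison
    through the intertwiner [P] makes [chi] invariant under some fiber map, hence trivial by
    [fiber_map_surjective]. The vectors fixed by all lamps then form a nonzero invariant
    subspace. *)
Lemma fixed_rep_lamp_trivial a : A a = 1%:M.
Proof.
have AA a' b : A (a' + b) = A a' *m A b by rewrite -rM emb_mul shc0 addr0.
have conjA g b : r g *m A b = A (shc (pr g) b) *m r g.
  rewrite -!rM -[g]embK !emb_mul pr_emb addr0 add0r shc0.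
  by congr (r (emb _ _)); rewrite addrC.
have [v v0 vA] : exists2 v : 'rV_d, v != 0 &
    forall B, (exists b, B = A b) -> exists c, v *m B = c *: v.
  apply: family_common_eigenvector => // _ _ [a1 ->] [a2 ->].
  by rewrite -!AA addrC.
have /choice[chi chiE] b : exists c, v *m A b = c *: v by apply: vA; exists b.
have dvv : dot v v != 0 by apply: contra_neq v0; apply: dot_eq0.
have scaleI c c' : c *: v = c' *: v -> c = c'.
  move=> e; apply: (mulIf dvv); by rewrite -!dotZ e.
have chiD a1 a2 : chi (a1 + a2) = chi a1 * chi a2.
  by apply: scaleI; rewrite -chiE AA mulmxA chiE -scalemxAl chiE scalerA.
have chi_norm b : (chi b)^* * chi b = 1.
  by apply: (mulIf dvv); rewrite mul1r -mulrA -dotZ -dotZr -chiE dot_unitary.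
have chi_neq0 b : chi b != 0.
  by apply/eqP => cb0; have /esym/eqP := chi_norm b; rewrite cb0 mulr0 oner_eq0.
have vP0 : v *m P != 0.
  apply: contra_neq v0 => vP; by rewrite -[v]mulmx1 -PP mulmxA vP mul0mx.
(* Otherwise [v *m P] is a nonzero vector orthogonal to the orbit of [v]; this orthogonal complement
   is invariant, so it is everything and contains [v]. *)
have [g vPg] : exists g, dot (v *m P) (v *m r g) != 0.
  apply: contrapT => /forallNP none.
  suff : dot v v = 0 by move/eqP: dvv.
  pose K w := forall g, dot w (v *m r g) = 0.
  suff KT w : K w by have := KT v (wr_one m k); rewrite rep1 mulmx1.
  apply: (irr_subspace (K := K)) => [g|w1 w2 K1 K2 g|c w1 K1 g|w1 h K1 g|].
  - by rewrite /dot mul0mx mxE.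
  - by rewrite dotD K1 K2 addr0.
  - by rewrite dotZ K1 mulr0.
  - by rewrite -[g](wr_mul1) -(wr_mulVg h) wr_mulA rM mulmxA dot_unitary.
  by exists (v *m P) => // g; apply/eqP/negPn/negP/none.
(* The two sides are the eigenvalues of the unitary [A b] at [v *m P] and at [v *m r g], which are
   not orthogonal. *)
have chi_phi b : chi (hom_lamp phi b) = chi (shc (pr g) b).
  apply: (mulfI (x := (chi (shc (pr g) b))^*)).
    by rewrite conjC_eq0.
  rewrite chi_norm; apply: (mulIf vPg); rewrite mul1r -mulrA -dotZ -dotZr.
  rewrite !scalemxAl -!chiE -hom_lampE //; last by case: aut_phi.
  by rewrite -!mulmxA rP -conjA !mulmxA dot_unitary.
have chi1 b : chi b = 1.
  (* Over this point the fiber map sends [c] to [hom_lamp phi (shc (- pr g) c)], where [chi] takes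
     the value [chi c] by [chi_phi]. *)
  have [c ->] := fiber_map_surjective m_gt0 k_gt0 aut_phi num_n
    (- pr g *m hom_mx phi) b.
  apply: (mulIf (chi_neq0 (fiber_map phi (- pr g *m hom_mx phi) c))).
  rewrite -chiD subrK mul1r /fiber_map -hom_lamp_shc //; last by case: aut_phi.
  by rewrite chi_phi shc_shc subrr shc0.
have KT (w : 'rV_d) : w *m A a = w.
  pose K (u : 'rV_d) := forall b, u *m A b = u.
  suff /(_ w a) : forall u, K u by [].
  apply: irr_subspace => [b|w1 w2 K1 K2 b|c w1 K1 b|w1 h K1 b|].
  - exact: mul0mx.
  - by rewrite mulmxDl K1 K2.
  - by rewrite -scalemxAl K1.
  - by rewrite -mulmxA conjA mulmxA K1.
  by exists v => // b; rewrite chiE chi1 scale1r.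
by apply/row_matrixP => i; rewrite rowE KT row1.
Qed.

Lemma fixed_rep_factors g h : pr g = pr h -> r g = r h.
Proof.
move=> e; rewrite -[g]embK -[h]embK e (emb_split (lam g)) (emb_split (lam h)).
by rewrite !rM !fixed_rep_lamp_trivial.
Qed.

(** Each [r g] depends only on [pr g], so these operators commute and the line of a common
    eigenvector is invariant. *)
Lemma fixed_rep_dim : d = 1%N.
Proof.
have [v v0 vr] : exists2 v : 'rV_d, v != 0 &
    forall B, (exists g, B = r g) -> exists c, v *m B = c *: v.
  apply: family_common_eigenvector => // _ _ [g ->] [h ->].
  by rewrite -!rM; apply: fixed_rep_factors; rewrite !prM addrC.
have [g|/eqP|<-] := r_irr (U := <<v>>%MS).
- have [c e] : exists c, v *m r g = c *: v by apply: vr; exists g.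
  by rewrite (eqmxMr _ (genmxE v)) genmxE e scalemx_sub.
- by rewrite genmxE mxrank_eq0 (negPf v0).
by rewrite genmxE rank_rV v0.
Qed.

End FixedRepresentation.

(** * Characters of [Zk k] as representations of the wreath product *)

Section CharacterRepresentation.
Variables m k : nat.

Definition char_rep (chi : Zk k -> CC) : rep m k :=
  existT _ 1%N (fun g => (chi (pr g))%:M).

Lemma char_rep_irr chi :
  (forall x y, chi (x + y) = chi x * chi y) -> (forall x, `|chi x| = 1) ->
  irr_unitary_rep (char_rep chi).
Proof.
move=> chiD chi1; split; last first.
  split=> // U _; have := rank_leq_row U.
  by rewrite /rep_dim /=; case: (\rank U) => [|[|]] //; [left|right].
rewrite /is_unitary_rep /rep_map /=; split=> [g|g h]; last first.
  by rewrite prM chiD scalar_mxM.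
by rewrite /unitary_mx adjmx_scalar -!scalar_mxM [_^* * _]mulrC -normCK chi1 expr1n.
Qed.

Lemma char_rep_equiv chi psi :
  rep_equiv (char_rep chi) (char_rep psi) -> chi =1 psi.
Proof.
move=> [P /= [PP [_ rP]]] z; have := rP (emb 0 z); rewrite pr_emb /rep_map /=.
rewrite mul_scalar_mx mul_mx_scalar => /(congr1 (fun M => (M *m adjmx P) 0 0)).
by rewrite -!scalemxAl PP !mxE !mulr1.
Qed.

End CharacterRepresentation.

(** Both numbers are the cardinality of [X], which indexes the cosets of the image of
    [1 - hom_mx phi] and the characters trivial on it. *)
Theorem theorem5p1 (m k : nat) :
  theorem5p1_group m k ->
  forall phi : wr m k -> wr m k, is_automorphism phi ->
  forall n : nat, num_classes (reid_rel phi) n ->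
  num_classes_on (fixed_irrep phi) (@rep_equiv m k) n.
Proof.
move=> Gmk phi aut_phi n num_n.
have [m_gt0 k_gt0] : (0 < m)%N /\ (0 < k)%N.
  case: Gmk => [[-> m_gt0 _]|[[m_pr _ k_gt0]|[-> [d [d_gt0 ->]]]]] //.
    by rewrite prime_gt0.
  by rewrite muln_gt0.
have phiM := proj2 aut_phi.
have reidP := reid_rel_prP m_gt0 k_gt0 aut_phi num_n.
have [X [F [chi [F_inj F_surj chi_inj chiP chi_all]]]] :=
  dual_of_quotient CC (det_neq0 m_gt0 aut_phi num_n).
have chi_phi x g : chi x (pr (phi g)) = chi x (pr g).
  have [chiD chiM _] := chiP x.
  rewrite pr_hom // -[in RHS](subrK (pr g *m hom_mx phi) (pr g)) chiD.
  by rewrite -[X in X - _](mulmx1 (pr g)) -mulmxBr chiM mul1r.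
have card_X : n = #|X|.
  have [f [f_inj f_surj]] := num_n.
  apply/eqP; rewrite eqn_leq; apply/andP; split.
    have /fin_all_exists[c cP] (i : 'I_n) :
        exists x y, pr (f i) - F x = y *m (1%:M - hom_mx phi).
      exact: F_surj.
    rewrite -[n in (n <= _)%N]card_ord; apply: (@leq_card _ _ c) => i j eq_c.
    have [[y ey] [y' ey']] := (cP i, cP j).
    apply/f_inj/reidP; exists (y' - y); rewrite mulmxBl -ey -ey' eq_c.
    by rewrite opprB addrA addrNK.
  have /fin_all_exists[c cP] (x : X) : exists i, reid_rel phi (emb 0 (F x)) (f i).
    exact: f_surj.
  rewrite -[n in (_ <= n)%N]card_ord; apply: (@leq_card _ _ c) => x x' eq_c.
  have : reid_rel phi (emb 0 (F x')) (emb 0 (F x)).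
    apply: (reid_rel_trans aut_phi (cP x')); rewrite -eq_c.
    exact: (reid_rel_sym aut_phi).
  by move=> /reidP[y]; rewrite !pr_emb => /F_inj.
pose e (i : 'I_n) : X := enum_val (cast_ord card_X i).
exists (fun i => char_rep m (chi (e i))); split=> [i|]; last split=> [i j|[d r]].
- have [chiD _ chi1] := chiP (e i); split; first exact: char_rep_irr.
  exists 1%:M; rewrite adjmx_scalar conjC1 !mulmx1; split=> //; split=> // g.
  by rewrite mulmx1 mul1mx /rep_map /= chi_phi.
- by move=> /char_rep_equiv/chi_inj/enum_val_inj/cast_ord_inj.
move=> [[[r_unitary rM] [d_gt0 r_irr]] [P /= [PP [_ rP]]]].
rewrite /rep_dim /rep_map /= in r_unitary rM d_gt0 r_irr P PP rP *.
have factor :=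
  fixed_rep_factors m_gt0 k_gt0 aut_phi num_n d_gt0 r_unitary rM r_irr PP rP.
have d1 :=
  fixed_rep_dim m_gt0 k_gt0 aut_phi num_n d_gt0 r_unitary rM r_irr PP rP.
subst d.
pose l z := r (emb 0 z) 0 0.
have rE g : r g = (l (pr g))%:M.
  by rewrite -mx11_scalar; apply: factor.
have lD z z' : l (z + z') = l z * l z'.
  have := rM (emb 0 z) (emb 0 z'); rewrite !rE prM !pr_emb -scalar_mxM.
  by move/matrixP/(_ 0 0); rewrite !mxE.
have l_neq0 z : l z != 0.
  have [+ _] := r_unitary (emb 0 z).
  rewrite rE mul_scalar_mx pr_emb => /matrixP/(_ 0 0).
  rewrite !mxE => e_l; apply/eqP => lz0; move/eqP: e_l.
  by rewrite lz0 mul0r eq_sym oner_eq0.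
(* In dimension 1 the intertwiner [P] is a nonzero scalar and cancels. *)
have lphi z : l (z *m hom_mx phi) = l z.
  have := rP (emb 0 z); rewrite !rE pr_hom // !pr_emb mul_scalar_mx mul_mx_scalar.
  move=> /(congr1 (fun M => (M *m adjmx P) 0 0)).
  by rewrite -!scalemxAl PP !mxE !mulr1.
have [|y|x lx] := chi_all l; first exact: lD.
  apply: (mulIf (l_neq0 (y *m hom_mx phi))).
  by rewrite -lD mulmxBr mulmx1 subrK lphi mul1r.
exists (cast_ord (esym card_X) (enum_rank x)).
exists 1%:M; rewrite adjmx_scalar conjC1 !mulmx1; split=> //; split=> // g.
rewrite mulmx1 mul1mx /rep_map /= rE lx /e cast_ord_comp cast_ord_id.
by rewrite enum_rankK.
Qed.
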